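(* Let $(\mathfrak{S},\mathfrak{C})$ be an EPRB-system, i.e. $\mathfrak{S}=\{(V_i,W_{i\oplus_4 1}):i\in\{1,\ldots,4\}\}$ and $\mathfrak{C}=\{\{V_i,W_i\}:i\in\{1,\ldots,4\}\}$. Then $$\Delta_0(\mathfrak{C})=\frac12\sum_{i=1}^4|\langle V_i\rangle-\langle W_i\rangle|,\qquad \Delta_{\min}(\mathfrak{S},\mathfrak{C})=\frac12\max\Big(2\Delta_0(\mathfrak{C}),\ \mathsf{s}_{odd}\big(\langle V_iW_{i\oplus_4 1}\rangle:i\in\{1,\ldots,4\}\big)-2\Big).$$ Consequently $$\mathsf{CNTX}(\mathfrak{S},\mathfrak{C})=\frac12\max\Big(0,\ \mathsf{s}_{odd}\big(\langle V_iW_{i\oplus_4 1}\rangle:i\in\{1,\ldots,4\}\big)-2-\sum_{i=1}^4|\langle V_i\rangle-\langle W_i\rangle|\Big),$$ and the system has a noncontextual description if and only if $$\mathsf{s}_{odd}\big(\langle V_iW_{i\oplus_4 1}\rangle:i\in\{1,\ldots,4\}\big)\le 2+\sum_{i=1}^4|\langle V_i\rangle-\langle W_i\rangle|.$$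
   Context: $\oplus_4$ denotes cyclic addition on $\{1,2,3,4\}$ ($4\oplus_4 1=1$). All $V_i,W_i$ are $\pm1$-valued random variables. Each pair $(V_i,W_{i\oplus_4 1})$ is jointly distributed, but variables in different pairs are stochastically unrelated (have no given joint distribution); in particular $V_i$ and $W_i$ are never jointly distributed. $\langle\cdot\rangle$ denotes expectation; $\langle V_iW_{i\oplus_4 1}\rangle$ is computed from the given joint distribution of the pair. A coupling of random variables $A,B$ is a jointly distributed pair $(A^*,B^* )$ with $A^*\sim A$, $B^*\sim B$; it is maximal if $\Pr[A^*=B^*]$ is the largest possible over all couplings. A coupling $S$ of $\mathfrak{S}$ is a jointly distributed 8-tuple $(V_1^*,\ldots,V_4^*,W_1^*,\ldots,W_4^* )$ with $(V_i^*,W_{i\oplus_4 1}^* )$ distributed as $(V_i,W_{i\oplus_4 1})$ for each $i$. The system has a (maximally) noncontextual description if some coupling $S$ has each $(V_i^*,W_i^* )$ a maximal coupling of $V_i,W_i$. $\Delta_0(\mathfrak{C})=\frac12\sum_i|\langle V_i\rangle-\langle W_i\rangle|$; $\Delta_{\min}(\mathfrak{S},\mathfrak{C})$ is the infimum over all couplings $S$ of $\sum_{i=1}^4\Pr[V_i^*\ne W_i^*]$; $\mathsf{CNTX}(\mathfrak{S},\mathfrak{C})=\Delta_{\min}(\mathfrak{S},\mathfrak{C})-\Delta_0(\mathfrak{C})$. For reals $a_1,\ldots,a_m$, $\mathsf{s}_{odd}(a_1,\ldots,a_m)$ is the maximum of $\sum_{i=1}^m(\pm a_i)$ over all sign choices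 with an odd number of minus signs. *)

(* Defs.v *)
From HB Require Import structures.
From mathcomp Require Import all_boot all_order all_algebra.
From mathcomp Require Import classical_sets reals.
Set Implicit Arguments. Unset Strict Implicit. Unset Printing Implicit Defensive.
Import Order.TTheory GRing.Theory Num.Theory.
Local Open Scope ring_scope.


Section EPRB.
Variable R : realType.

(* a +-1 valued random variable takes values in bool; true = +1, false = -1 *)
Definition sgn (b : bool) : R := if b then 1 else -1.

Definition is_distr (T : finType) (p : {ffun T -> R}) : Prop :=
  (forall x, 0 <= p x) /\ \sum_x p x = 1.

(* cyclic successor / predecessor on 'I_4 = {1,2,3,4} (shifted to 0..3) *)
Definition oplus1 (i : 'I_4) : 'I_4 := ordS i.
Definition ominus1 (i : 'I_4) : 'I_4 := ord_pred i.

(* An EPRB system: P i is the joint distribution of the pair (V_i, W_{i (+) 1}). *)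
Definition EPRB_system (P : 'I_4 -> {ffun bool * bool -> R}) : Prop :=
  forall i, is_distr (P i).

(* <V_i> and <W_i>; W_i occurs in the pair with index i (-) 1 *)
Definition EV (P : 'I_4 -> {ffun bool * bool -> R}) (i : 'I_4) : R :=
  \sum_(x : bool * bool) P i x * sgn x.1.
Definition EW (P : 'I_4 -> {ffun bool * bool -> R}) (i : 'I_4) : R :=
  \sum_(x : bool * bool) P (ominus1 i) x * sgn x.2.
Definition Ecorr (P : 'I_4 -> {ffun bool * bool -> R}) (i : 'I_4) : R :=
  \sum_(x : bool * bool) P i x * (sgn x.1 * sgn x.2).

Definition Delta0 (P : 'I_4 -> {ffun bool * bool -> R}) : R :=
  2^-1 * \sum_(i < 4) `|EV P i - EW P i|.

(* sample space of the coupled 8-tuple: a pair of sign vectors, starred V and starred W *)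
Definition Omega := ({ffun 'I_4 -> bool} * {ffun 'I_4 -> bool})%type.

Definition is_coupling (P : 'I_4 -> {ffun bool * bool -> R}) (S : {ffun Omega -> R})
  : Prop :=
  is_distr S /\
  forall (i : 'I_4) (a b : bool),
    \sum_(w : Omega | (w.1 i == a) && (w.2 (oplus1 i) == b)) S w = P i (a, b).

Definition mismatch (S : {ffun Omega -> R}) (i : 'I_4) : R :=
  \sum_(w : Omega | w.1 i != w.2 i) S w.

Definition Deltamin (P : 'I_4 -> {ffun bool * bool -> R}) : R :=
  inf [set x : R | exists S, is_coupling P S /\ x = \sum_(i < 4) mismatch S i]%classic.

Definition CNTX (P : 'I_4 -> {ffun bool * bool -> R}) : R := Deltamin P - Delta0 P.

Definition lawV (P : 'I_4 -> {ffun bool * bool -> R}) (i : 'I_4) (a : bool) : R :=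
  \sum_(b : bool) P i (a, b).
Definition lawW (P : 'I_4 -> {ffun bool * bool -> R}) (i : 'I_4) (b : bool) : R :=
  \sum_(a : bool) P (ominus1 i) (a, b).

Definition is_coupling2 (pa pb : bool -> R) (q : {ffun bool * bool -> R}) : Prop :=
  is_distr q /\ (forall a, \sum_(b : bool) q (a, b) = pa a)
             /\ (forall b, \sum_(a : bool) q (a, b) = pb b).

Definition agree (q : {ffun bool * bool -> R}) : R := \sum_(a : bool) q (a, a).

Definition maximal_coupling (pa pb : bool -> R) (q : {ffun bool * bool -> R}) : Prop :=
  is_coupling2 pa pb q /\ forall q', is_coupling2 pa pb q' -> agree q' <= agree q.

Definition pair_law (S : {ffun Omega -> R}) (i : 'I_4) : {ffun bool * bool -> R} :=
  [ffun x : bool * bool => \sum_(w : Omega | (w.1 i == x.1) && (w.2 i == x.2)) S w].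

Definition noncontextual (P : 'I_4 -> {ffun bool * bool -> R}) : Prop :=
  exists S, is_coupling P S /\
    forall i : 'I_4, maximal_coupling (lawV P i) (lawW P i) (pair_law S i).

(* s_odd: max of sum (+-a_i) over sign choices with an odd number of minus
   signs (s i = true means a minus sign at i).  The big max is seeded with the
   value of one admissible choice (minus only at index 0), so it is exactly the
   maximum over the admissible choices. *)
Definition signed_sum (a : 'I_4 -> R) (s : {ffun 'I_4 -> bool}) : R :=
  \sum_(i < 4) (if s i then - a i else a i).
Definition s_odd (a : 'I_4 -> R) : R :=
  \big[Num.max/signed_sum a [ffun i : 'I_4 => i == ord0]]_(s : {ffun 'I_4 -> bool}
      | odd #|[set i | s i]|) signed_sum a s.

End EPRB.

(* Main.v *)
Require Import Defs.
From HB Require Import structures.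
From mathcomp Require Import all_boot all_order all_algebra.
From mathcomp Require Import classical_sets reals.
From mathcomp Require Import lra ring.
Set Implicit Arguments.
Unset Strict Implicit.
Unset Printing Implicit Defensive.
Import Order.TTheory GRing.Theory Num.Theory.
Local Open Scope ring_scope.

(* Around a closed chain of signs the products of neighbours multiply to 1, so
   the correlations of neighbours satisfy the odd cycle inequalities: a signed
   sum of [m] correlations with an odd number of minus signs is at most [m - 2].
   Together with the Frechet bounds on each edge they are also sufficient: a
   chord splits the chain into a shorter one and a triangle, its correlation can
   be chosen to satisfy the inequalities of both, and the two laws are glued
   conditionally on the ends of the chord.

   An EPRB system is the chain V_0 W_1 V_1 W_2 V_2 W_3 V_3 W_0 closed by the
   edge W_0 V_0.  The edges V_i W_(i+1) are given, and on the edges W_i V_i the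
   largest correlation is 1 - |<V_i> - <W_i>|.  A minus sign on an edge of
   largest correlation makes the cycle inequality automatic, so it is enough to
   lower the correlation of W_0 V_0 alone, until the s_odd inequality holds. *)

Section FiniteLaws.
Variable R : realType.
Implicit Types T U : finType.

Lemma sum_pair (A B : finType) (F : A * B -> R) :
  \sum_v F v = \sum_a \sum_b F (a, b).
Proof.
by rewrite (pair_bigA _ (fun a b => F (a, b))) /=; apply: eq_bigr => -[].
Qed.

Definition expect T (S : {ffun T -> R}) (f : T -> R) : R := \sum_w S w * f w.

Lemma eq_expect T (S : {ffun T -> R}) (f g : T -> R) :
  f =1 g -> expect S f = expect S g.
Proof. by move=> fg; apply: eq_bigr => w _; rewrite fg. Qed.

Lemma expectD T (S : {ffun T -> R}) (f g : T -> R) :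
  expect S (fun w => f w + g w) = expect S f + expect S g.
Proof.
by rewrite /expect -big_split; apply: eq_bigr => w _; rewrite mulrDr.
Qed.

Lemma expectZ T (S : {ffun T -> R}) (c : R) (f : T -> R) :
  expect S (fun w => c * f w) = c * expect S f.
Proof.
by rewrite /expect big_distrr; apply: eq_bigr => w _; rewrite /= mulrCA.
Qed.

Lemma expect_sum T (I : finType) (S : {ffun T -> R}) (f : I -> T -> R) :
  expect S (fun w => \sum_i f i w) = \sum_i expect S (f i).
Proof.
by rewrite /expect exchange_big; apply: eq_bigr => w _; rewrite /= big_distrr.
Qed.

Lemma expect_cst T (S : {ffun T -> R}) (c : R) :
  is_distr S -> expect S (fun=> c) = c.
Proof. by case=> _ S1; rewrite /expect -big_distrl /= S1 mul1r. Qed.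

Lemma expect_le T (S : {ffun T -> R}) (f g : T -> R) :
  is_distr S -> (forall w, f w <= g w) -> expect S f <= expect S g.
Proof. by case=> S0 _ fg; apply: ler_sum => w _; rewrite ler_wpM2l. Qed.

Lemma prob_expect T (S : {ffun T -> R}) (p : pred T) :
  \sum_(w | p w) S w = expect S (fun w => (p w)%:R).
Proof.
rewrite big_mkcond; apply: eq_bigr => w _.
by case: (p w); rewrite ?mulr1 ?mulr0.
Qed.

Definition pushforward T U (S : {ffun T -> R}) (F : T -> U) : {ffun U -> R} :=
  [ffun u => \sum_(t | F t == u) S t].

Lemma expect_pushforward T U (S : {ffun T -> R}) (F : T -> U) (f : U -> R) :
  expect (pushforward S F) f = expect S (f \o F).
Proof.
rewrite /expect [RHS](partition_big F xpredT) //=; apply: eq_bigr => u _.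
by rewrite ffunE big_distrl /=; apply: eq_bigr => t /eqP ->.
Qed.

Lemma sum_pushforward T U (S : {ffun T -> R}) (F : T -> U) :
  \sum_u pushforward S F u = \sum_t S t.
Proof.
rewrite [RHS](partition_big F xpredT) //.
by apply: eq_bigr => u _; rewrite ffunE.
Qed.

Lemma is_distr_pushforward T U (S : {ffun T -> R}) (F : T -> U) :
  is_distr S -> is_distr (pushforward S F).
Proof.
by case=> S0 S1; split=> [u|]; rewrite ?sum_pushforward // ffunE sumr_ge0.
Qed.

Lemma pushforward_fst (A B : finType) (t : {ffun A * B -> R}) (a : A) :
  pushforward t fst a = \sum_b t (a, b).
Proof.
rewrite ffunE big_mkcond sum_pair (bigD1 a) //= eqxx [X in _ + X]big1 ?addr0 //.
by move=> a' /negPf na'; rewrite na' big1.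
Qed.

(* The new coordinate is drawn conditionally on [h w] alone. *)
Lemma markov_extension T (A B : finType) (S : {ffun T -> R}) (h : T -> A)
    (t : {ffun A * B -> R}) :
  is_distr S -> is_distr t -> pushforward t fst = pushforward S h ->
  exists S' : {ffun T * B -> R},
    [/\ is_distr S', pushforward S' fst = S
      & pushforward S' (fun w => (h w.1, w.2)) = t].
Proof.
move=> [S0 S1] [t0 _] tS; pose p := pushforward S h.
have tE a : \sum_b t (a, b) = p a by rewrite -pushforward_fst tS.
pose S' := [ffun w : T * B => S w.1 * (t (h w.1, w.2) / p (h w.1))].
have S'_fst : pushforward S' fst = S.
  apply/ffunP => w; rewrite pushforward_fst.
  have -> : \sum_b S' (w, b) = \sum_b S w * (t (h w, b) / p (h w)).
    by apply: eq_bigr => b _; rewrite ffunE.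
  rewrite -big_distrr -big_distrl /= tE.
  have [pw|pw] := eqVneq (p (h w)) 0; last by rewrite divff // mulr1.
  move: (pw); rewrite /p ffunE => /(psumr_eq0P (fun w' _ => S0 w')) ->.
    by rewrite mul0r.
  by rewrite eqxx.
exists S'; split=> //.
  split=> [w|]; last by rewrite -(sum_pushforward S' fst) S'_fst.
  by rewrite ffunE mulr_ge0 // divr_ge0 // ffunE sumr_ge0.
apply/ffunP => -[a b]; transitivity (p a * (t (a, b) / p a)).
  rewrite ffunE big_mkcond sum_pair /p !ffunE big_distrl [RHS]big_mkcond /=.
  apply: eq_bigr => w _; rewrite (bigD1 b) //= [X in _ + X]big1 ?addr0.
    by rewrite xpair_eqE eqxx andbT ffunE /= !ffunE; case: eqP => // ->.
  by move=> b' /negPf nb'; rewrite xpair_eqE nb' andbF.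
have [pa|pa] := eqVneq (p a) 0; last by rewrite mulrCA divff // mulr1.
move: pa; rewrite -tE => /(psumr_eq0P (fun b' _ => t0 (a, b'))) -> //.
by rewrite mul0r mulr0.
Qed.

End FiniteLaws.

Section SignMoments.
Variable R : realType.
Implicit Types (T U : finType) (q : {ffun bool * bool -> R}).
Local Notation sg := (sgn R).

Lemma sgnE (b : bool) : sg b = (-1) ^+ (~~ b).
Proof. by case: b. Qed.

Definition mean T (S : {ffun T -> R}) (X : T -> bool) : R :=
  expect S (fun w => sg (X w)).

Definition corr T (S : {ffun T -> R}) (X Y : T -> bool) : R :=
  expect S (fun w => sg (X w) * sg (Y w)).

Lemma corrC T (S : {ffun T -> R}) (X Y : T -> bool) : corr S X Y = corr S Y X.
Proof. by apply: eq_expect => w; rewrite mulrC. Qed.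

Lemma corr_self T (S : {ffun T -> R}) (X : T -> bool) :
  is_distr S -> corr S X X = 1.
Proof.
move=> Sd; rewrite -(expect_cst 1 Sd); apply: eq_expect => w.
by rewrite /sgn; case: (X w); rewrite ?mulrNN mulr1.
Qed.

Lemma mean_pushforward T U (S : {ffun T -> R}) (F : T -> U) (X : U -> bool) :
  mean (pushforward S F) X = mean S (X \o F).
Proof. exact: expect_pushforward. Qed.

Lemma corr_pushforward T U (S : {ffun T -> R}) (F : T -> U) (X Y : U -> bool) :
  corr (pushforward S F) X Y = corr S (X \o F) (Y \o F).
Proof. exact: expect_pushforward. Qed.

Lemma prob_neqE T (S : {ffun T -> R}) (X Y : T -> bool) :
  is_distr S -> \sum_(w | X w != Y w) S w = 2^-1 * (1 - corr S X Y).
Proof.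
move=> Sd; rewrite prob_expect -[X in X - _](expect_cst 1 Sd) -mulN1r.
rewrite /corr -expectZ -expectD -expectZ; apply: eq_expect => w.
by case: (X w); case: (Y w); rewrite /sgn /=; lra.
Qed.

Lemma pair_lawE q (a b : bool) : is_distr q ->
  q (a, b) = 4^-1 * (1 + sg a * mean q fst + sg b * mean q snd
                     + sg a * sg b * corr q fst snd).
Proof.
case=> _; rewrite /mean /corr /expect !sum_pair !big_bool /sgn /=.
by case: a; case: b; lra.
Qed.

Lemma eq_pair_law q q' : is_distr q -> is_distr q' ->
  mean q fst = mean q' fst -> mean q snd = mean q' snd ->
  corr q fst snd = corr q' fst snd -> q = q'.
Proof.
move=> qd q'd eq_fst eq_snd eq_corr; apply/ffunP => -[a b].
by rewrite !pair_lawE // eq_fst eq_snd eq_corr.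
Qed.

(* The Frechet bounds on the correlation of two signs of means [x] and [y]. *)
Definition frechet (x y c : R) : Prop :=
  forall b : bool, (-1) ^+ b * c <= 1 - `|x - (-1) ^+ b * y|.

Lemma frechetP (x y c : R) :
  frechet x y c <->
  forall p q : bool,
    0 <= 1 + (-1) ^+ p * x + (-1) ^+ q * y + (-1) ^+ p * (-1) ^+ q * c.
Proof.
split=> [xyc p q|pos b]; last first.
  rewrite lerBrDr -lerBrDl ler_norml.
  have := pos false (~~ b); have := pos true b.
  by case: b => /= ? ?; apply/andP; split; lra.
have := xyc (~~ (p (+) q)); rewrite lerBrDr -lerBrDl ler_norml.
by case: p; case: q => /= /andP[? ?]; lra.
Qed.

Lemma frechet_corr T (S : {ffun T -> R}) (X Y : T -> bool) :
  is_distr S -> frechet (mean S X) (mean S Y) (corr S X Y).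
Proof.
move=> Sd; apply/frechetP => p q.
rewrite -[X in X <= _](expect_cst 0 Sd).
rewrite -[X in _ <= X + _ + _ + _](expect_cst 1 Sd).
rewrite /mean /corr -!expectZ -!expectD; apply: expect_le => // w.
by case: (X w); case: (Y w); case: p; case: q; rewrite /sgn /=; lra.
Qed.

Lemma frechet_norm_mean (x y c : R) : frechet x y c -> `|x| <= 1.
Proof.
move/frechetP => pos; rewrite ler_norml.
have := pos false false; have := pos false true.
have := pos true false; have := pos true true => /= *.
by apply/andP; split; lra.
Qed.

Lemma frechet_norm_corr (x y c : R) : frechet x y c -> `|c| <= 1.
Proof.
move=> xyc; rewrite ler_norml.
have := xyc false; have := xyc true; rewrite !mulN1r !mul1r opprK.
have := normr_ge0 (x + y); have := normr_ge0 (x - y) => *.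
by apply/andP; split; lra.
Qed.

Lemma frechetC (x y c : R) : frechet x y c -> frechet y x c.
Proof.
by move=> /frechetP pos; apply/frechetP => p q; have := pos q p => /=; lra.
Qed.

Lemma frechet_max (x y : R) :
  `|x| <= 1 -> `|y| <= 1 -> frechet x y (1 - `|x - y|).
Proof.
rewrite !ler_norml => /andP[? ?] /andP[? ?] [] /=; last by rewrite !mul1r.
by case: (ger0P (x - y)); case: (ger0P (x - -1 * y)) => *; lra.
Qed.

Lemma frechet_trans (x y z c D : R) (a r : bool) :
  frechet y z c -> frechet x z D ->
  (-1) ^+ r * c - (-1) ^+ (~~ a (+) r) * D <= 2 - `|x - (-1) ^+ a * y|.
Proof.
move=> yzc xzD; rewrite addNb signrN.
have := yzc r; have := xzD (a (+) r); rewrite signr_addb.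
have := ler_distD ((-1) ^+ a * ((-1) ^+ r * z)) x ((-1) ^+ a * y).
by rewrite -mulrBr normrMsign (distrC _ y) !mulrA; lra.
Qed.

End SignMoments.

Section SignExtension.
Variable R : realType.
Local Notation sg := (sgn R).

Lemma exists_signed_bounded (U : bool -> set R) :
  (forall b, U b !=set0)%classic ->
  (forall u v, U false u -> U true v -> 0 <= u + v) ->
  exists D : R, forall b u, U b u -> (-1) ^+ b * D <= u.
Proof.
move=> Un0 Ucompat; exists (- inf (U true)) => -[] u Uu.
  rewrite mulN1r opprK; apply: ge_inf => //.
  have [u0 Uu0] := Un0 false; exists (- u0) => v Uv.
  by rewrite -subr_ge0 opprK addrC Ucompat.
rewrite mul1r lerNl; apply: lb_le_inf => // v Uv.
by rewrite -subr_ge0 opprK addrC Ucompat.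
Qed.

Definition triangle_ineq (a b d : R) : Prop :=
  forall s t : bool,
    (-1) ^+ s * a + (-1) ^+ t * b - (-1) ^+ (s (+) t) * d <= 1.

Lemma third_moment (x y z a b d : R) :
  frechet x y a -> frechet y z b -> frechet x z d -> triangle_ineq a b d ->
  exists u : R, forall p q r : bool,
    0 <= 1 + (-1) ^+ p * x + (-1) ^+ q * y + (-1) ^+ r * z
           + (-1) ^+ p * (-1) ^+ q * a + (-1) ^+ q * (-1) ^+ r * b
           + (-1) ^+ p * (-1) ^+ r * d + (-1) ^+ p * (-1) ^+ q * (-1) ^+ r * u.
Proof.
move=> /frechetP xya /frechetP yzb /frechetP xzd abd.
pose bound (p q r : bool) := 1 + (-1) ^+ p * x + (-1) ^+ q * y + (-1) ^+ r * z
  + (-1) ^+ p * (-1) ^+ q * a + (-1) ^+ q * (-1) ^+ r * b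
  + (-1) ^+ p * (-1) ^+ r * d.
(* Opposite sign triples differ in one sign or in all three: the first case is
   a pair bound and the second a triangle inequality. *)
have [||u ubound] := @exists_signed_bounded (fun s v =>
  exists p q r, p (+) q (+) r = ~~ s /\ v = bound p q r).
- move=> s; exists (bound (~~ s) false false), (~~ s), false, false.
  by rewrite !addbF.
- move=> _ _ [p [q [r [pqr ->]]]] [p' [q' [r' [pqr' ->]]]]; rewrite /bound.
  have := xya p q; have := yzb q r; have := xzd p r.
  have := abd (~~ (p (+) q)) (~~ (q (+) r)).
  move: p q r p' q' r' pqr pqr' => [] [] [] // [] [] [] //= _ _; lra.
exists u => p q r.
have : (-1) ^+ (~~ (p (+) q (+) r)) * u <= bound p q r.
  by apply: ubound; exists p, q, r; rewrite negbK.
by rewrite /bound signrN !signr_addb; lra.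
Qed.

Lemma triple_law (x y z a b d : R) :
  frechet x y a -> frechet y z b -> frechet x z d -> triangle_ineq a b d ->
  exists t : {ffun bool * bool * bool -> R},
    let X v := v.1.1 in let Y v := v.1.2 in let Z v := v.2 in
    [/\ is_distr t, [/\ mean t X = x, mean t Y = y & mean t Z = z]
      & [/\ corr t X Y = a, corr t Y Z = b & corr t X Z = d]].
Proof.
move=> xya yzb xzd abd; have [u pos] := third_moment xya yzb xzd abd.
exists [ffun v : bool * bool * bool =>
  8^-1 * (1 + sg v.1.1 * x + sg v.1.2 * y + sg v.2 * z + sg v.1.1 * sg v.1.2 * a
          + sg v.1.2 * sg v.2 * b + sg v.1.1 * sg v.2 * d
          + sg v.1.1 * sg v.1.2 * sg v.2 * u)].
split; first split.
- by move=> -[[p q] r]; rewrite ffunE /= !sgnE mulr_ge0 ?invr_ge0 ?ler0n.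
- by rewrite !sum_pair !big_bool !ffunE /sgn /=; lra.
- by split; rewrite /mean /expect !sum_pair !big_bool !ffunE /sgn /=; lra.
- by split; rewrite /corr /expect !sum_pair !big_bool !ffunE /sgn /=; lra.
Qed.

Lemma extend_by_sign (T : finType) (S : {ffun T -> R}) (X Y : T -> bool)
    (z b d : R) :
  is_distr S -> frechet (mean S Y) z b -> frechet (mean S X) z d ->
  triangle_ineq (corr S X Y) b d ->
  exists S' : {ffun T * bool -> R},
    [/\ is_distr S', pushforward S' fst = S, mean S' snd = z,
        corr S' (Y \o fst) snd = b & corr S' (X \o fst) snd = d].
Proof.
move=> Sd yzb xzd abd.
have [t [td [tX tY tZ] [tXY tYZ tXZ]]] :=
  triple_law (frechet_corr X Y Sd) yzb xzd abd.
have t_fst : pushforward t fst = pushforward S (fun w => (X w, Y w)).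
  by apply: eq_pair_law; rewrite ?mean_pushforward ?corr_pushforward //;
    apply: is_distr_pushforward.
have [S' [S'd S'fst S't]] := markov_extension Sd td t_fst.
exists S'; split=> //; rewrite -?tZ -?tYZ -?tXZ -S't.
- by rewrite mean_pushforward.
- by rewrite corr_pushforward.
- by rewrite corr_pushforward.
Qed.

Lemma exists_sign_law (m : R) : `|m| <= 1 ->
  exists S : {ffun bool -> R}, is_distr S /\ mean S id = m.
Proof.
rewrite ler_norml => /andP[m1 m2].
exists [ffun b => 2^-1 * (1 + sg b * m)]; split; last first.
  by rewrite /mean /expect big_bool !ffunE /sgn /=; lra.
split=> [b|]; last by rewrite big_bool !ffunE /sgn /=; lra.
by rewrite ffunE /sgn; case: b; lra.
Qed.

Lemma exists_pair_law (x y c : R) : frechet x y c ->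
  exists q,
    [/\ is_distr q, mean q fst = x, mean q snd = y & corr q fst snd = c].
Proof.
move=> xyc; have [S [Sd Sx]] := exists_sign_law (frechet_norm_mean xyc).
have [|||q [qd q_fst qy qc _]] := @extend_by_sign _ S id id y c c Sd.
- by rewrite Sx.
- by rewrite Sx.
- rewrite corr_self // => s t; have := frechet_norm_corr xyc; rewrite ler_norml.
  by case: s; case: t => /= /andP[? ?]; lra.
by exists q; split=> //; rewrite -Sx -q_fst mean_pushforward.
Qed.

End SignExtension.

Section SignPatterns.
Variable R : realType.
Implicit Types (s e : nat -> bool) (x c : nat -> R).

Definition odd_minus n s : bool := \big[addb/false]_(k < n) s k.

Lemma eq_odd_minus n s e :
  (forall k : 'I_n, s k = e k) -> odd_minus n s = odd_minus n e.
Proof. by move=> se; apply: eq_bigr => k _; rewrite se. Qed.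

Lemma odd_minusS n s : odd_minus n.+1 s = odd_minus n s (+) s n.
Proof. by rewrite /odd_minus big_ord_recr. Qed.

Lemma odd_minusD n s e :
  odd_minus n (fun k => s k (+) e k) = odd_minus n s (+) odd_minus n e.
Proof. exact: big_split. Qed.

Lemma odd_minus_pred1 n j : (j < n)%N -> odd_minus n (pred1 j) = true.
Proof.
move=> jn; rewrite /odd_minus (bigD1 (Ordinal jn)) //= eqxx big1 // => k.
by apply: contraNF => /eqP kj; apply/eqP/val_inj.
Qed.

Lemma sum_signs_le n e :
  \sum_(k < n) (-1) ^+ e k - (-1) ^+ odd_minus n e <= n%:R - 1 :> R.
Proof.
elim: n => [|n IH]; first by rewrite /odd_minus !big_ord0.
rewrite big_ord_recr odd_minusS signr_addb -natr1 /=.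
by move: IH; case: (e n); case: (odd_minus n e) => /=; lra.
Qed.

Lemma signed_telescope n s x :
  \sum_(k < n) (-1) ^+ odd_minus k s * (x k - (-1) ^+ s k * x k.+1) =
  x 0 - (-1) ^+ odd_minus n s * x n.
Proof.
elim: n => [|n IH]; first by rewrite /odd_minus !big_ord0 mul1r subrr.
by rewrite big_ord_recr IH odd_minusS signr_addb /=; ring.
Qed.

Lemma norm_signed_path n s x :
  `|x 0 - (-1) ^+ odd_minus n s * x n| <=
  \sum_(k < n) `|x k - (-1) ^+ s k * x k.+1|.
Proof.
rewrite -signed_telescope (le_trans (ler_norm_sum _ _ _)) //.
by apply: ler_sum => k _; rewrite normrMsign.
Qed.

Lemma norm_signed_polygon n s x (j : 'I_n) :
  `|x j - (-1) ^+ s j * x j.+1| <= `|x 0 - (-1) ^+ odd_minus n s * x n|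
    + \sum_(k < n | k != j) `|x k - (-1) ^+ s k * x k.+1|.
Proof.
rewrite -signed_telescope (bigD1 j) //=; set others := \sum_(k < n | _) _ * _.
rewrite -[X in X <= _](normrMsign (odd_minus j s)) -{1}[_ * _](addrK others).
rewrite (le_trans (ler_normB _ _)) // lerD2l (le_trans (ler_norm_sum _ _ _)) //.
by apply: ler_sum => k _; rewrite normrMsign.
Qed.

End SignPatterns.

Section ClosedChainInequality.
Variables (R : realType) (c : nat -> R).
Implicit Types (n : nat) (D : R) (s e : nat -> bool).

Definition signed_chain n s : R := \sum_(k < n) (-1) ^+ s k * c k.

(* [D] is the correlation of the edge that closes the chain, with the sign that
   makes the number of minus signs odd. *)
Definition closed_chain_ineq n D : Prop :=
  forall s, signed_chain n s - (-1) ^+ odd_minus n s * D <= n%:R - 1.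

Lemma eq_signed_chain n s e :
  (forall k : 'I_n, s k = e k) -> signed_chain n s = signed_chain n e.
Proof. by move=> se; apply: eq_bigr => k _; rewrite se. Qed.

Lemma signed_chainS n s :
  signed_chain n.+1 s = signed_chain n s + (-1) ^+ s n * c n.
Proof. exact: big_ord_recr. Qed.

Lemma closed_chain_ineqS n D : closed_chain_ineq n.+1 D -> forall s (r : bool),
  signed_chain n s + (-1) ^+ r * c n - (-1) ^+ (odd_minus n s (+) r) * D
    <= n%:R.
Proof.
move=> nD s r; pose s' k := if k == n then r else s k.
have s's (k : 'I_n) : s' k = s k by rewrite /s' ltn_eqF.
have := nD s'; rewrite signed_chainS odd_minusS -natr1 addrK {2 4}/s' eqxx.
by rewrite (eq_signed_chain s's) (eq_odd_minus s's).
Qed.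

End ClosedChainInequality.

Lemma closed_chain_ineq_corr (R : realType) (T : finType) (S : {ffun T -> R})
    (X : nat -> T -> bool) n :
  is_distr S ->
  closed_chain_ineq (fun k => corr S (X k) (X k.+1)) n (corr S (X 0) (X n)).
Proof.
move=> Sd s; pose e w k := s k (+) (X k w (+) X k.+1 w).
have e_odd w : odd_minus n (e w) = odd_minus n s (+) (X 0 w (+) X n w).
  rewrite odd_minusD; congr (_ (+) _); elim: n => [|n IH].
    by rewrite /odd_minus big_ord0 addbb.
  by rewrite odd_minusS IH -addbA addKb.
have sgM (a b : bool) : sgn R a * sgn R b = (-1) ^+ (a (+) b).
  by rewrite !sgnE -signr_addb addNb addbN negbK.
rewrite /signed_chain /corr -mulNr -expectZ.
under eq_bigr do rewrite -expectZ.
rewrite -expect_sum -expectD -(expect_cst (n%:R - 1) Sd).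
apply: expect_le => // w; apply: le_trans (sum_signs_le R n (e w)).
rewrite e_odd signr_addb -mulNr sgM lerD2r; apply: ler_sum => k _.
by rewrite sgM -signr_addb.
Qed.

Section Chains.
Variable R : realType.
Variables x c : nat -> R.
Implicit Types (n : nat) (D : R) (s e : nat -> bool).

Local Notation signed_chain := (signed_chain c).
Local Notation closed_chain_ineq := (closed_chain_ineq c).

Definition chain_frechet n : Prop :=
  forall k, (k < n)%N -> frechet (x k) (x k.+1) (c k).

Definition chain_realizable n D : Prop :=
  exists (T : finType) (S : {ffun T -> R}) (X : nat -> T -> bool),
    [/\ is_distr S, forall k, (k <= n)%N -> mean S (X k) = x k,
        forall k, (k < n)%N -> corr S (X k) (X k.+1) = c k
      & corr S (X 0) (X n) = D].

Lemma signed_chain_slack n s : chain_frechet n ->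
  signed_chain n s <= n%:R - \sum_(k < n) `|x k - (-1) ^+ s k * x k.+1|.
Proof.
move=> xc; rewrite -[n in n%:R]card_ord -sumr_const -sumrB.
by apply: ler_sum => k _; apply: xc.
Qed.

Lemma signed_chain_le n s : chain_frechet n ->
  signed_chain n s <= n%:R - `|x 0 - (-1) ^+ odd_minus n s * x n|.
Proof.
move=> xc; apply: le_trans (signed_chain_slack s xc) _.
by rewrite lerD2l lerN2 norm_signed_path.
Qed.

Lemma signed_chain_opposite n s e : chain_frechet n ->
  odd_minus n s != odd_minus n e ->
  signed_chain n s + signed_chain n e <= 2 * (n%:R - 1).
Proof.
move=> xc neq; pose d k := s k (+) e k.
have /(le_trans _): n%:R + \sum_(k < n) (-1) ^+ d k <= 2 * (n%:R - 1) :> R.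
  have := sum_signs_le R n d; rewrite odd_minusD -negb_eqb neq /=; lra.
apply; rewrite -[n in n%:R]card_ord -sumr_const -!big_split /=.
apply: ler_sum => k _.
have := xc k (ltn_ord k) => /[dup] /(_ false) c1 /(_ true) c2.
have := normr_ge0 (x k - (-1) ^+ false * x k.+1).
have := normr_ge0 (x k - (-1) ^+ true * x k.+1).
by rewrite /d; case: (s k) c1 c2; case: (e k) => /=; lra.
Qed.

Lemma closed_chain_ineq_tight n D s (j : 'I_n) :
  chain_frechet n -> frechet (x 0) (x n) D ->
  c j = 1 - `|x j - x j.+1| -> s j ->
  signed_chain n s - (-1) ^+ odd_minus n s * D <= n%:R - 1.
Proof.
move=> xc xD cj sj; pose e k := s k (+) (k == j).
have := norm_signed_polygon e x j.
have -> : e j = false by rewrite /e eqxx sj.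
have -> : odd_minus n e = ~~ odd_minus n s.
  by rewrite odd_minusD (odd_minus_pred1 (ltn_ord j)) addbT.
have := xD (~~ odd_minus n s); rewrite [X in X * D]signrN mul1r.
have : \sum_(k < n | k != j) (-1) ^+ s k * c k <=
    n%:R - 1 - \sum_(k < n | k != j) `|x k - (-1) ^+ e k * x k.+1|.
  have <- : \sum_(k < n | k != j) 1 = n%:R - 1 :> R.
    rewrite -[n in n%:R]card_ord -sumr_const [in RHS](bigD1 j) //=.
    by rewrite [RHS]addrC addKr.
  rewrite -sumrB; apply: ler_sum => k /negPf kj; rewrite /e val_eqE kj addbF.
  exact: xc.
have -> : signed_chain n s = - c j + \sum_(k < n | k != j) (-1) ^+ s k * c k.
  by rewrite /signed_chain (bigD1 j) //= sj mulN1r.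
by rewrite cj; lra.
Qed.

(* The upper bounds on [(-1) ^+ b * D] that allow a chain of length [n], closed
   by an edge of correlation [D], to be extended to one closed by [D']. *)
Definition chord_bound n D' (b : bool) : set R :=
  [set u | [\/ u = 1 - `|x 0 - (-1) ^+ b * x n|,
      exists2 s, odd_minus n s = ~~ b & u = n%:R - 1 - signed_chain n s
    | exists r : bool,
        u = 1 - (-1) ^+ r * c n + (-1) ^+ (b (+) r) * D']]%classic.

Lemma chord_bound_compat n D' b u v :
  chain_frechet n.+1 -> frechet (x 0) (x n.+1) D' ->
  closed_chain_ineq n.+1 D' ->
  chord_bound n D' b u -> chord_bound n D' (~~ b) v -> 0 <= u + v.
Proof.
move=> xc xD' nD'; have xcn := xc n (ltnSn n).
have xc' : chain_frechet n by move=> k /ltnW; apply: xc.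
have pair_pair (a : bool) : 0 <= (1 - `|x 0 - (-1) ^+ a * x n|)
    + (1 - `|x 0 - (-1) ^+ (~~ a) * x n|).
  have x0n := frechet_max (frechet_norm_mean xD') (frechet_norm_mean xcn).
  by have := x0n false; have := x0n true; case: a => /=; lra.
have pair_chain (a : bool) s : odd_minus n s = ~~ ~~ a ->
    0 <= (1 - `|x 0 - (-1) ^+ a * x n|) + (n%:R - 1 - signed_chain n s).
  by have := signed_chain_le s xc'; rewrite negbK => /[swap] ->; lra.
have pair_triangle (a r : bool) : 0 <= (1 - `|x 0 - (-1) ^+ a * x n|)
    + (1 - (-1) ^+ r * c n + (-1) ^+ (~~ a (+) r) * D').
  by have := frechet_trans a r xcn xD'; lra.
have chain_chain (a : bool) s s' :
    odd_minus n s = ~~ a -> odd_minus n s' = ~~ ~~ a ->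
    0 <= (n%:R - 1 - signed_chain n s) + (n%:R - 1 - signed_chain n s').
  move=> sa s'a; have := @signed_chain_opposite n s s' xc'.
  by rewrite sa s'a eq_sym negb_eqb addNb addbb => /(_ isT); lra.
have chain_triangle (a : bool) s (r : bool) : odd_minus n s = ~~ a ->
    0 <= (n%:R - 1 - signed_chain n s)
      + (1 - (-1) ^+ r * c n + (-1) ^+ (~~ a (+) r) * D').
  by move=> <-; have := closed_chain_ineqS nD' s r; lra.
have triangle_triangle (a r r' : bool) :
    0 <= (1 - (-1) ^+ r * c n + (-1) ^+ (a (+) r) * D')
    + (1 - (-1) ^+ r' * c n + (-1) ^+ (~~ a (+) r') * D').
  have := frechet_norm_corr xD'; have := frechet_norm_corr xcn.
  rewrite !ler_norml.
  by case: a; case: r; case: r' => /= /andP[? ?] /andP[? ?]; lra.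
move=> [->|[s sb ->]|[r ->]] [->|[s' s'b ->]|[r' ->]].
- exact: pair_pair.
- exact: pair_chain.
- exact: pair_triangle.
- by rewrite addrC; apply: pair_chain; rewrite negbK.
- exact: chain_chain sb s'b.
- exact: chain_triangle.
- by rewrite addrC -{2}[b]negbK; apply: pair_triangle.
- by rewrite addrC -{1}[b]negbK; apply: chain_triangle.
- exact: triangle_triangle.
Qed.

Lemma exists_chord n D' :
  chain_frechet n.+1 -> frechet (x 0) (x n.+1) D' ->
  closed_chain_ineq n.+1 D' ->
  exists D, [/\ frechet (x 0) (x n) D, closed_chain_ineq n D
    & triangle_ineq D (c n) D'].
Proof.
move=> xc xD' nD'.
have [|u v|D Dbound] := @exists_signed_bounded _ (chord_bound n D').
- by move=> b; exists (1 - `|x 0 - (-1) ^+ b * x n|); apply: Or31.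
- exact: (chord_bound_compat (b := false)).
exists D; split=> [b|s|b r].
- by apply: Dbound; apply: Or31.
- have : (-1) ^+ (~~ odd_minus n s) * D <= n%:R - 1 - signed_chain n s.
    by apply: Dbound; apply: Or32; exists s; rewrite ?negbK.
  by rewrite signrN; lra.
- have : (-1) ^+ b * D <= 1 - (-1) ^+ r * c n + (-1) ^+ (b (+) r) * D'.
    by apply: Dbound; apply: Or33; exists r.
  by lra.
Qed.

Theorem closed_chain_realizable n D :
  chain_frechet n -> frechet (x 0) (x n) D -> closed_chain_ineq n D ->
  chain_realizable n D.
Proof.
elim: n D => [|n IH] D' xc xD' nD'.
  have [S [Sd Sx]] := exists_sign_law (frechet_norm_mean xD').
  exists bool, S, (fun=> id); split=> // [k|].
    by rewrite leqn0 => /eqP ->.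
  rewrite corr_self //; apply/eqP; rewrite eq_le; apply/andP; split.
    have := nD' (fun=> false).
    by rewrite /signed_chain /odd_minus !big_ord0 /=; lra.
  by have := xD' false; rewrite !mul1r subrr normr0 subr0.
have [D [xD nD DcD']] := exists_chord xc xD' nD'.
have xcn := xc n (ltnSn n).
have xc' : chain_frechet n by move=> k /ltnW; apply: xc.
have [T [S [X [Sd SX Sc SD]]]] := IH D xc' xD nD.
have [|||S' [S'd S'fst S'z S'c S'D]] :=
    @extend_by_sign _ _ S (X 0) (X n) (x n.+1) (c n) D' Sd.
- by rewrite SX.
- by rewrite SX.
- by rewrite SD.
pose X' k (w : T * bool) := if (k <= n)%N then X k w.1 else w.2.
exists (T * bool)%type, S', X'; rewrite /X'; split=> //.
- move=> k le_kn; have /predU1P[->|kn] : (k == n.+1) || (k <= n)%N.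
  - by rewrite -ltnS -leq_eqVlt.
  - by rewrite ltnn.
  by rewrite -SX // -S'fst mean_pushforward kn.
- move=> k lt_kn; have /predU1P[->|kn] : (k == n) || (k < n)%N.
  - by rewrite -leq_eqVlt.
  - by rewrite leqnn ltnn.
  by rewrite -Sc // -S'fst corr_pushforward kn (ltnW kn).
- by rewrite ltnn.
Qed.

(* By [closed_chain_ineq_tight] only sign patterns without a minus sign on a
   tight edge restrict the closing edge; [A] is the largest such odd sum. *)
Lemma closing_edge_realizable n (tight : pred nat) (A : R) :
  `|x 0| <= 1 -> `|x n| <= 1 -> chain_frechet n ->
  (forall k, tight k -> c k = 1 - `|x k - x k.+1|) ->
  (forall m, A <= m <-> forall s, odd_minus n s ->
     (forall k : 'I_n, tight k -> ~~ s k) -> signed_chain n s <= m) ->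
  chain_realizable n (Num.min (1 - `|x 0 - x n|) (n%:R - 1 - A)).
Proof.
move=> x0 xn xc c_tight A_sup; set D := Num.min _ _.
have A_max s : odd_minus n s -> (forall k : 'I_n, tight k -> ~~ s k) ->
    signed_chain n s <= A.
  by move: s; apply/A_sup.
have [D_pair D_chain] : D <= 1 - `|x 0 - x n| /\ D <= n%:R - 1 - A.
  by split; rewrite /D ge_min lexx ?orbT.
have xD : frechet (x 0) (x n) D.
  move=> [] /=; rewrite ?mul1r // !mulN1r opprK lerNl le_min.
  apply/andP; split.
    have := frechet_max x0 xn true; rewrite !mulN1r opprK; lra.
  suff : A <= n%:R - `|x 0 + x n| by lra.
  apply/A_sup => s s_odd _; have := signed_chain_le s xc.
  by rewrite s_odd mulN1r opprK.
apply: closed_chain_realizable => // s.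
have [/existsP[j /andP[tj sj]]|] := boolP [exists j : 'I_n, tight j && s j].
  exact: closed_chain_ineq_tight xc xD (c_tight _ tj) sj.
rewrite negb_exists => /forallP s_tight.
have {}s_tight (k : 'I_n) : tight k -> ~~ s k.
  by have := s_tight k; rewrite negb_and => /orP[/negbTE->|].
have [s_odd|s_even] := boolP (odd_minus n s).
  by rewrite mulN1r opprK; have := A_max s s_odd s_tight; lra.
rewrite mul1r /D; case: (leP (1 - `|x 0 - x n|)) => _.
  by have := signed_chain_le s xc; rewrite (negbTE s_even) mul1r; lra.
suff : A <= 2 * (n%:R - 1) - signed_chain n s by lra.
apply/A_sup => e e_odd _; have := signed_chain_opposite xc (s := e) (e := s).
by rewrite e_odd (negbTE s_even) => /(_ isT); lra.
Qed.

End Chains.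

Section MaximalCouplings.
Variable R : realType.
Implicit Types (q : {ffun bool * bool -> R}) (pa pb : bool -> R).
Local Notation sg := (sgn R).

Lemma marginal_fstE q a : is_distr q ->
  \sum_b q (a, b) = 2^-1 * (1 + sg a * mean q fst).
Proof. by move=> qd; rewrite big_bool !pair_lawE // /sgn /=; lra. Qed.

Lemma marginal_sndE q b : is_distr q ->
  \sum_a q (a, b) = 2^-1 * (1 + sg b * mean q snd).
Proof. by move=> qd; rewrite big_bool !pair_lawE // /sgn /=; lra. Qed.

Lemma agreeE q : is_distr q -> agree q = 2^-1 * (1 + corr q fst snd).
Proof. by move=> qd; rewrite /agree big_bool !pair_lawE // /sgn /=; lra. Qed.

Lemma coupling2_eq_mean pa pb q q' :
  is_coupling2 pa pb q -> is_coupling2 pa pb q' ->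
  mean q' fst = mean q fst /\ mean q' snd = mean q snd.
Proof.
move=> [qd [qa qb]] [q'd [q'a q'b]].
have := qa true; rewrite -q'a !marginal_fstE //.
by have := qb true; rewrite -q'b !marginal_sndE //= /sgn => *; split; lra.
Qed.

Lemma coupling2_of_mean pa pb q q' : is_coupling2 pa pb q -> is_distr q' ->
  mean q' fst = mean q fst -> mean q' snd = mean q snd -> is_coupling2 pa pb q'.
Proof.
move=> [qd [qa qb]] q'd e_fst e_snd; split=> //; split=> a.
  by rewrite -qa !marginal_fstE // e_fst.
by rewrite -qb !marginal_sndE // e_snd.
Qed.

Lemma maximal_couplingP pa pb q : is_coupling2 pa pb q ->
  maximal_coupling pa pb q <-> corr q fst snd = 1 - `|mean q fst - mean q snd|.
Proof.
move=> qc; have [qd _] := qc.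
have corr_le q' : is_coupling2 pa pb q' ->
    corr q' fst snd <= 1 - `|mean q fst - mean q snd|.
  move=> q'c; have [q'd _] := q'c; have := frechet_corr fst snd q'd false.
  by have [-> ->] := coupling2_eq_mean qc q'c; rewrite !mul1r.
split=> [[_ q_max]|q_corr]; last first.
  split=> // q' q'c; have := corr_le _ q'c.
  by rewrite (agreeE qd) (agreeE (proj1 q'c)) q_corr; lra.
have pair_q := frechet_corr fst snd qd.
have [fst_norm snd_norm] : `|mean q fst| <= 1 /\ `|mean q snd| <= 1.
  by split; apply: frechet_norm_mean; [|apply: frechetC]; exact: pair_q.
have [q0 [q0d q0_fst q0_snd q0_corr]] :=
  exists_pair_law (frechet_max fst_norm snd_norm).
have := q_max _ (coupling2_of_mean qc q0d q0_fst q0_snd).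
by rewrite !agreeE // q0_corr; have := corr_le _ qc; lra.
Qed.

End MaximalCouplings.

Section OddSignedSums.
Variable R : realType.
Implicit Types (a : 'I_4 -> R).

Lemma odd_card_addb (I : finType) (p : pred I) :
  odd #|[set i | p i]| = \big[addb/false]_i p i.
Proof.
rewrite cardsE -sum1_card big_mkcond.
rewrite (big_morph odd oddD (erefl : odd 0 = false)).
by apply: eq_bigr => i _; rewrite unfold_in; case: (p i).
Qed.

Lemma signed_sumE a (s : {ffun 'I_4 -> bool}) :
  signed_sum a s = \sum_(i < 4) (-1) ^+ s i * a i.
Proof. by apply: eq_bigr => i _; rewrite mulr_sign. Qed.

Lemma s_odd_leP a (m : R) :
  reflect (forall s : {ffun 'I_4 -> bool},
             \big[addb/false]_i s i -> signed_sum a s <= m)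
          (s_odd a <= m).
Proof.
apply: (iffP (bigmax_leP _ _ _ _)) => [[_ le_m] s|le_m].
  by rewrite -odd_card_addb; apply: le_m.
split=> [|s]; last by rewrite odd_card_addb; apply: le_m.
by apply: le_m; rewrite !big_ord_recl big_ord0 !ffunE.
Qed.

End OddSignedSums.

Lemma big_ord_double (T : Type) (idx : T) (op : Monoid.com_law idx) n
    (F : nat -> T) :
  \big[op/idx]_(k < n.*2.+1) F k =
  op (\big[op/idx]_(i < n.+1) F i.*2) (\big[op/idx]_(i < n) F i.*2.+1).
Proof.
elim: n => [|n IH]; first by rewrite !big_ord_recr !big_ord0 /= Monoid.mulm1.
rewrite doubleS !(big_ord_recr n.*2.+1, big_ord_recr n.*2.+2) IH /=.
rewrite [in RHS]big_ord_recr [X in _ = op _ X]big_ord_recr /= doubleS.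
by rewrite -Monoid.mulmA [X in _ X = _]Monoid.mulmC Monoid.mulmACA.
Qed.

Section Interleave.
Variable n : nat.

(* The cyclic sequence [v 0, w 1, v 1, w 2, ..., v n, w 0]. *)
Definition interleave T (v w : 'I_n.+1 -> T) (k : nat) : T :=
  if odd k then w (inZp (uphalf k)) else v (inZp k./2).

Lemma ordS_inZp k : ordS (inZp k : 'I_n.+1) = inZp k.+1.
Proof. by apply: val_inj; rewrite /= -addn1 modnDml addn1. Qed.

Lemma lift0_inZp (j : 'I_n) : lift ord0 j = inZp j.+1.
Proof. by apply: val_inj; rewrite /= modn_small // ltnS. Qed.

Lemma interleave_double T (v w : 'I_n.+1 -> T) (i : 'I_n.+1) :
  interleave v w i.*2 = v i.
Proof. by rewrite /interleave odd_double doubleK valZpK. Qed.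

Lemma interleave_double_ordS T (v w : 'I_n.+1 -> T) (i : 'I_n.+1) :
  interleave v w i.*2.+1 = w (ordS i).
Proof.
by rewrite /interleave /= odd_double /= doubleK -ordS_inZp valZpK.
Qed.

Lemma interleave_doubleS T (v w : 'I_n.+1 -> T) (j : 'I_n) :
  interleave v w j.*2.+1 = w (lift ord0 j).
Proof. by rewrite /interleave /= odd_double /= doubleK lift0_inZp. Qed.

Lemma interleave_doubleSS T (v w : 'I_n.+1 -> T) (j : 'I_n) :
  interleave v w j.*2.+2 = v (lift ord0 j).
Proof. by rewrite /interleave /= odd_double /= doubleK lift0_inZp. Qed.

Lemma interleave0 T (v w : 'I_n.+1 -> T) : interleave v w 0 = v ord0.
Proof. exact: (interleave_double v w ord0). Qed.

Lemma interleave_last T (v w : 'I_n.+1 -> T) :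
  interleave v w n.*2.+1 = w ord0.
Proof.
rewrite /interleave /= odd_double /= doubleK; congr w.
by apply: val_inj; rewrite /= modnn.
Qed.

Definition even_signs (s : 'I_n.+1 -> bool) : nat -> bool :=
  interleave s (fun=> false).

Lemma odd_minus_even_signs (s : 'I_n.+1 -> bool) :
  odd_minus n.*2.+1 (even_signs s) = \big[addb/false]_i s i.
Proof.
rewrite /odd_minus big_ord_double /= [X in _ (+) X]big1 => [|i _].
  by rewrite addbF; apply: eq_bigr => i _; rewrite [LHS]interleave_double.
exact: interleave_doubleS.
Qed.

Lemma signed_chain_even_signs (R : realType) (s : 'I_n.+1 -> bool)
    (c : nat -> R) :
  signed_chain c n.*2.+1 (even_signs s) =
  \sum_i (-1) ^+ s i * c i.*2 + \sum_(i < n) c i.*2.+1.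
Proof.
pose F k := (-1) ^+ even_signs s k * c k.
rewrite /signed_chain (big_ord_double _ _ F) /F /even_signs.
congr (_ + _); apply: eq_bigr => i _; first by rewrite interleave_double.
by rewrite interleave_doubleS mul1r.
Qed.

Lemma even_signsE (s : nat -> bool) :
  (forall k : 'I_(n.*2.+1), odd k -> ~~ s k) ->
  forall k : 'I_(n.*2.+1), s k = even_signs [ffun i : 'I_n.+1 => s i.*2] k.
Proof.
move=> s_odd k; rewrite /even_signs /interleave.
case: ifP => [/s_odd/negbTE //|k_even].
have k2 : (k./2 < n.+1)%N by rewrite ltnS leq_half_double ltnW.
by rewrite ffunE /= modn_small // -[in LHS](odd_double_half k) k_even.
Qed.

End Interleave.

Section EPRBCouplings.
Variable R : realType.
Variable P : 'I_4 -> {ffun bool * bool -> R}.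
Hypothesis P_EPRB : EPRB_system P.
Implicit Types (S : {ffun Omega -> R}) (i : 'I_4).

Definition valV i (w : Omega) : bool := w.1 i.
Definition valW i (w : Omega) : bool := w.2 i.

Lemma oplus1K : cancel oplus1 ominus1.
Proof. exact: ordSK. Qed.

Lemma ominus1K : cancel ominus1 oplus1.
Proof. exact: ord_predK. Qed.

Lemma frechet_EPRB i : frechet (EV P i) (EW P (oplus1 i)) (Ecorr P i).
Proof. by rewrite /EW oplus1K; apply: (frechet_corr fst snd (P_EPRB i)). Qed.

Lemma EV_norm i : `|EV P i| <= 1.
Proof. exact: frechet_norm_mean (frechet_EPRB i). Qed.

Lemma EW_norm i : `|EW P i| <= 1.
Proof.
by rewrite -[i]ominus1K; apply: frechet_norm_mean (frechetC (frechet_EPRB _)).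
Qed.

Lemma is_couplingP S : is_coupling P S <-> is_distr S /\
  forall i, pushforward S (fun w => (valV i w, valW (oplus1 i) w)) = P i.
Proof.
split=> -[Sd SP]; split=> // i.
  apply/ffunP => -[a b]; rewrite -SP ffunE.
  by apply: eq_bigl => w; rewrite xpair_eqE.
by move=> a b; rewrite -SP ffunE; apply: eq_bigl => w; rewrite xpair_eqE.
Qed.

Lemma coupling_moments S : is_coupling P S <->
  [/\ is_distr S, forall i, mean S (valV i) = EV P i,
      forall i, mean S (valW i) = EW P i
    & forall i, corr S (valV i) (valW (oplus1 i)) = Ecorr P i].
Proof.
split=> [/is_couplingP[Sd SP]|[Sd SV SW SC]].
  split=> // i; first by rewrite -[RHS]/(mean (P i) fst) -SP mean_pushforward.
    rewrite -[RHS]/(mean (P (ominus1 i)) snd) -SP mean_pushforward.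
    by rewrite ominus1K.
  by rewrite -[RHS]/(corr (P i) fst snd) -SP corr_pushforward.
apply/is_couplingP; split=> // i.
apply: eq_pair_law; rewrite ?mean_pushforward ?corr_pushforward //.
- exact: is_distr_pushforward.
- by rewrite SV.
- by rewrite SW /EW oplus1K.
- exact: SC.
Qed.

Lemma mismatchE S i :
  is_distr S -> mismatch S i = 2^-1 * (1 - corr S (valV i) (valW i)).
Proof. exact: prob_neqE. Qed.

Lemma sum_mismatch S : is_distr S ->
  \sum_(i < 4) mismatch S i = 2^-1 * (4 - \sum_i corr S (valV i) (valW i)).
Proof.
move=> Sd; rewrite (eq_bigr _ (fun i _ => mismatchE i Sd)) -big_distrr sumrB.
by rewrite sumr_const card_ord.
Qed.

Lemma mismatch_ge S i :
  is_coupling P S -> 2^-1 * `|EV P i - EW P i| <= mismatch S i.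
Proof.
move=> /coupling_moments[Sd <- <- _]; rewrite mismatchE //.
by have := frechet_corr (valV i) (valW i) Sd false; rewrite !mul1r; lra.
Qed.

Lemma Delta0_le_mismatch S :
  is_coupling P S -> Delta0 P <= \sum_(i < 4) mismatch S i.
Proof.
move=> Sc; rewrite /Delta0 big_distrr.
by apply: ler_sum => i _; apply: mismatch_ge.
Qed.

Lemma s_odd_le_mismatch S : is_coupling P S ->
  s_odd (Ecorr P) <= 2 + 2 * \sum_(i < 4) mismatch S i.
Proof.
move=> /coupling_moments[Sd _ _ SC]; apply/s_odd_leP => s s_odd.
have := closed_chain_ineq_corr (interleave valV valW) 7 Sd (even_signs s).
rewrite (signed_chain_even_signs (n := 3)) (odd_minus_even_signs (n := 3)).
rewrite s_odd mulN1r opprK.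
under eq_bigr do rewrite interleave_double interleave_double_ordS SC.
under [X in _ + X + _]eq_bigr do
  rewrite interleave_doubleS interleave_doubleSS corrC.
rewrite -signed_sumE interleave0 (interleave_last (n := 3)).
by rewrite sum_mismatch // [X in 4 - X]big_ord_recl; lra.
Qed.

Definition cycle_mean : nat -> R := interleave (EV P) (EW P).

Definition cycle_corr : nat -> R :=
  interleave (Ecorr P) (fun i => 1 - `|EV P i - EW P i|).

Lemma cycle_mean_norm k : `|cycle_mean k| <= 1.
Proof.
by rewrite /cycle_mean /interleave; case: ifP => _; rewrite ?EW_norm ?EV_norm.
Qed.

Lemma cycle_corr_tight k :
  odd k -> cycle_corr k = 1 - `|cycle_mean k - cycle_mean k.+1|.
Proof.
by move=> k_odd; rewrite /cycle_corr /cycle_mean /interleave /= k_odd distrC.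
Qed.

Lemma cycle_frechet n : chain_frechet cycle_mean cycle_corr n.
Proof.
move=> k _; have [/cycle_corr_tight ->|/negbTE k_even] := boolP (odd k).
  by apply: frechet_max; apply: cycle_mean_norm.
rewrite /cycle_corr /cycle_mean /interleave /= k_even /= -ordS_inZp.
exact: frechet_EPRB.
Qed.

Lemma s_odd_cycle_sup (m : R) :
  s_odd (Ecorr P) + \sum_(j < 3) cycle_corr j.*2.+1 <= m <->
  forall s, odd_minus 7 s -> (forall k : 'I_7, odd k -> ~~ s k) ->
    signed_chain cycle_corr 7 s <= m.
Proof.
have chainE (s : {ffun 'I_4 -> bool}) :
    signed_chain cycle_corr 7 (even_signs s) =
    signed_sum (Ecorr P) s + \sum_(j < 3) cycle_corr j.*2.+1.
  rewrite (signed_chain_even_signs (n := 3)) signed_sumE; congr (_ + _).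
  by apply: eq_bigr => i _; rewrite /cycle_corr interleave_double.
split=> [|le_m].
  rewrite -lerBrDr => /s_odd_leP le_m s s_odd s_even.
  have sE := even_signsE (n := 3) s_even.
  rewrite (eq_signed_chain _ sE) chainE -lerBrDr; apply: le_m.
  by rewrite -(odd_minus_even_signs (n := 3)) -(eq_odd_minus sE).
rewrite -lerBrDr; apply/s_odd_leP => s s_odd.
rewrite lerBrDr -chainE; apply: le_m.
  by rewrite (odd_minus_even_signs (n := 3)).
by move=> k k_odd; rewrite /even_signs /interleave k_odd.
Qed.

Section CycleState.
Variables (T : finType) (S : {ffun T -> R}) (X : nat -> T -> bool).

Definition cycle_state (t : T) : Omega :=
  ([ffun i : 'I_4 => X i.*2 t], [ffun i : 'I_4 => X (ominus1 i).*2.+1 t]).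

Lemma valV_cycle_state i : valV i \o cycle_state =1 X i.*2.
Proof. by move=> t; rewrite /= /valV ffunE. Qed.

Lemma valW_cycle_state i : valW i \o cycle_state =1 X (ominus1 i).*2.+1.
Proof. by move=> t; rewrite /= /valW ffunE. Qed.

Lemma is_coupling_cycle_state :
  is_distr S -> (forall k, (k <= 7)%N -> mean S (X k) = cycle_mean k) ->
  (forall k, (k < 7)%N -> corr S (X k) (X k.+1) = cycle_corr k) ->
  is_coupling P (pushforward S cycle_state).
Proof.
move=> Sd SX SC.
have double_lt7 i : (i.*2 < 7)%N.
  by rewrite -[7%N]/(3.*2.+1) ltnS leq_double -ltnS.
have meanV i : mean S (X i.*2) = EV P i.
  by rewrite SX 1?ltnW // /cycle_mean interleave_double.
have meanW i : mean S (X i.*2.+1) = EW P (oplus1 i).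
  by rewrite SX // /cycle_mean interleave_double_ordS.
have corrVW i : corr S (X i.*2) (X i.*2.+1) = Ecorr P i.
  by rewrite SC // /cycle_corr interleave_double.
apply/coupling_moments; split=> [|i|i|i].
- exact: is_distr_pushforward.
- rewrite mean_pushforward -meanV; apply: eq_expect => t.
  by rewrite valV_cycle_state.
- rewrite mean_pushforward -[in RHS](ominus1K i) -meanW; apply: eq_expect => t.
  by rewrite valW_cycle_state.
- rewrite corr_pushforward -corrVW; apply: eq_expect => t.
  by rewrite valV_cycle_state valW_cycle_state oplus1K.
Qed.

Lemma sum_corr_cycle_state :
  \sum_i corr (pushforward S cycle_state) (valV i) (valW i) =
  corr S (X 0) (X 7) + \sum_(j < 3) corr S (X j.*2.+1) (X j.*2.+2).
Proof.
have corrE i : corr (pushforward S cycle_state) (valV i) (valW i) =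
    corr S (X i.*2) (X (ominus1 i).*2.+1).
  rewrite corr_pushforward; apply: eq_expect => t.
  by rewrite valV_cycle_state valW_cycle_state.
rewrite big_ord_recl corrE; congr (_ + _); apply: eq_bigr => j _.
rewrite corrE corrC; congr (corr S (X _.*2.+1) _).
by rewrite lift0_inZp -ordS_inZp oplus1K /= modn_small // ltnS ltnW.
Qed.

End CycleState.

Lemma optimal_coupling : exists S, is_coupling P S /\
  \sum_(i < 4) mismatch S i
    = 2^-1 * Num.max (2 * Delta0 P) (s_odd (Ecorr P) - 2).
Proof.
have [T [S [X [Sd SX SC SD]]]] := closing_edge_realizable (cycle_mean_norm 0)
  (cycle_mean_norm 7) (@cycle_frechet 7) cycle_corr_tight s_odd_cycle_sup.
exists (pushforward S (cycle_state X)); split.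
  exact: is_coupling_cycle_state.
rewrite sum_mismatch; last exact: is_distr_pushforward.
rewrite sum_corr_cycle_state SD.
set A := s_odd _; set C := \sum_(j < 3) cycle_corr _.
have -> : \sum_(j < 3) corr S (X j.*2.+1) (X j.*2.+2) = C.
  by apply: eq_bigr => j _; rewrite SC // -[7%N]/(3.*2.+1) ltnS ltn_double.
have -> : 2 * Delta0 P = 3 - C + `|cycle_mean 0 - cycle_mean 7|.
  rewrite /cycle_mean interleave0 (interleave_last (n := 3)).
  rewrite /Delta0 mulVKf ?pnatr_eq0 // big_ord_recl addrC; congr (_ + _).
  rewrite /C /cycle_corr; under [in RHS]eq_bigr do rewrite interleave_doubleS.
  by rewrite sumrB sumr_const card_ord opprB addrCA subrr addr0.
move: `|cycle_mean 0 - cycle_mean 7| => d.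
by case: (leP (1 - d)) => ?; case: (leP (3 - C + d)) => ?; lra.
Qed.

Lemma inf_attained (A : set R) (m : R) : A m -> lbound A m -> inf A = m.
Proof.
move=> Am A_ge; apply/eqP; rewrite eq_le; apply/andP; split.
  by apply: ge_inf => //; exists m.
by apply: lb_le_inf => //; exists m.
Qed.

Lemma DeltaminE :
  Deltamin P = 2^-1 * Num.max (2 * Delta0 P) (s_odd (Ecorr P) - 2).
Proof.
apply: inf_attained => [|_ [S [Sc ->]]].
  by have [S [Sc <-]] := optimal_coupling; exists S.
have := Delta0_le_mismatch Sc; have := s_odd_le_mismatch Sc.
by case: (leP (2 * Delta0 P)) => _; lra.
Qed.

Lemma maximal_pair_lawP S i : is_coupling P S ->
  maximal_coupling (lawV P i) (lawW P i) (pair_law S i) <->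
  mismatch S i = 2^-1 * `|EV P i - EW P i|.
Proof.
move=> /coupling_moments[Sd SV SW _].
have -> : pair_law S i = pushforward S (fun w => (valV i w, valW i w)).
  by apply/ffunP => -[a b]; rewrite !ffunE; apply: eq_bigl.
set q := pushforward _ _; have qd : is_distr q by apply: is_distr_pushforward.
have q_fst : mean q fst = EV P i by rewrite mean_pushforward -SV.
have q_snd : mean q snd = EW P i by rewrite mean_pushforward -SW.
have qc : is_coupling2 (lawV P i) (lawW P i) q.
  split=> //; split=> a; first by rewrite /lawV !marginal_fstE // q_fst.
  by rewrite /lawW !marginal_sndE // q_snd.
rewrite (maximal_couplingP qc) q_fst q_snd corr_pushforward mismatchE //.
by split=> [->|]; lra.
Qed.

Lemma noncontextualP : noncontextual P <->
  exists S, is_coupling P S /\ \sum_(i < 4) mismatch S i = Delta0 P.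
Proof.
split=> -[S [Sc S_max]]; exists S; split=> //.
  rewrite /Delta0 big_distrr; apply: eq_bigr => i _.
  exact/maximal_pair_lawP.
have excess_ge0 i : true -> 0 <= mismatch S i - 2^-1 * `|EV P i - EW P i|.
  by rewrite subr_ge0 mismatch_ge.
move=> i; apply/maximal_pair_lawP => //; apply: subr0_eq.
apply: (psumr_eq0P excess_ge0) => //.
by rewrite sumrB -big_distrr /= S_max subrr.
Qed.

End EPRBCouplings.

Theorem theorem35 (R : realType) (P : 'I_4 -> {ffun bool * bool -> R}) :
  EPRB_system P ->
  [/\ Delta0 P = 2^-1 * \sum_(i < 4) `|EV P i - EW P i|,
      Deltamin P = 2^-1 * Num.max (2 * Delta0 P) (s_odd (Ecorr P) - 2),
      CNTX P = 2^-1 * Num.max 0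
                 (s_odd (Ecorr P) - 2 - \sum_(i < 4) `|EV P i - EW P i|)
    & (noncontextual P <->
       s_odd (Ecorr P) <= 2 + \sum_(i < 4) `|EV P i - EW P i|)].
Proof.
move=> P_EPRB; set s := s_odd _; set d := \sum_(i < 4) _.
have Delta0E : Delta0 P = 2^-1 * d by [].
split=> //; first exact: DeltaminE.
  rewrite /CNTX DeltaminE // -/s Delta0E.
  by case: (leP (2 * (2^-1 * d))) => ?; case: (leP 0 (s - 2 - d)) => ?; lra.
rewrite noncontextualP //; split=> [[S [Sc S_min]]|s_le].
  by have := s_odd_le_mismatch P_EPRB Sc; rewrite S_min Delta0E -/s; lra.
have [S [Sc S_opt]] := optimal_coupling P_EPRB; exists S; split=> //.
by rewrite S_opt -/s Delta0E; case: (leP (2 * (2^-1 * d))) => ?; lra.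
Qed.
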